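(* Let $m\ge2$ be an integer and for $r\ge1$ let $|GHZ_{(r)}\rangle=\frac{1}{\sqrt r}\sum_{k=0}^{r-1}|k\rangle^{\otimes m}$. Then the Schmidt rank of $|GHZ_{(r)}\rangle$ with respect to every bipartition of the $m$ modes into two nonempty sets is $r$. Moreover: (i) if $r'<r$, then for every $\varepsilon>0$ there is a vector that is SLOCC-equivalent to $|GHZ_{(r)}\rangle$ and lies within norm distance $\varepsilon$ of $|GHZ_{(r')}\rangle$; (ii) if $r'>r$, then there are no vectors SLOCC-equivalent to $|GHZ_{(r)}\rangle$ arbitrarily close in norm to $|GHZ_{(r')}\rangle$.
   Context: The state space is $\mathcal{H}=\mathcal{H}_1\otimes\cdots\otimes\mathcal{H}_m$, where each mode space $\mathcal{H}_k$ is a copy of the Fock space with orthonormal number basis $|0\rangle,|1\rangle,|2\rangle,\ldots$. Two (possibly unnormalized) vectors $|\Psi\rangle,|\Phi\rangle\in\mathcal{H}$ are SLOCC-equivalent if there are invertible operators $A_k$ on $\mathcal{H}_k$ (bounded with bounded inverse), $k=1,\ldots,m$, with $|\Phi\rangle=A_1\otimes\cdots\otimes A_m|\Psi\rangle$. For a bipartition $\{1,\ldots,m\}=I\sqcup J$ into nonempty sets, the Schmidt rank of a vector is its tensor rank in $\left(\bigotimes_{i\in I}\mathcal{H}_i\right)\otimes\left(\bigotimes_{j\in J}\mathcal{H}_j\right)$, i.e. the rank of its coefficient matrix with rows indexed by the basis of the first factor and columns by the basis of the second. *)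

(* Defs.v *)
(* The complex scalars are R[i], for an arbitrary R : realType. *)
From HB Require Import structures.
From mathcomp Require Import all_boot all_order all_algebra.
From mathcomp Require Import finmap.
From mathcomp Require Import all_classical all_reals all_analysis.
From mathcomp Require Import ring.
From mathcomp Require Export complex.

Set Implicit Arguments.
Unset Strict Implicit.
Unset Printing Implicit Defensive.

Import Order.TTheory GRing.Theory Num.Theory.

Local Open Scope ring_scope.
Local Open Scope complex_scope.
Local Open Scope classical_set_scope.

Section EllTwo.
Variables (R : realType) (T : choiceType).

Definition sqmod (z : R[i]) : R := complex.Re z ^+ 2 + complex.Im z ^+ 2.

Lemma sqmod_ge0 z : 0 <= sqmod z.
Proof. by rewrite addr_ge0 ?sqr_ge0. Qed.

Lemma sqmodM z w : sqmod (z * w) = sqmod z * sqmod w.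
Proof. by case: z w => [a b] [c d]; rewrite /sqmod/=; ring. Qed.

Lemma sqmodD z w : sqmod (z + w) <= 2 * sqmod z + 2 * sqmod w.
Proof.
case: z w => [a b] [c d]; rewrite /sqmod/= -subr_ge0.
rewrite (_ : _ - _ = (a - c) ^+ 2 + (b - d) ^+ 2) ?addr_ge0 ?sqr_ge0//.
by ring.
Qed.

Definition sqsum (f : T -> R[i]) : \bar R :=
  esum setT (fun t => (sqmod (f t))%:E).

Definition ell2_pred : {pred T -> R[i]} :=
  fun f => `[< (sqsum f < +oo)%E >].

Lemma sqsum_bounded (f : T -> R[i]) (M : R) :
  (forall s : seq T, uniq s -> \sum_(t <- s) sqmod (f t) <= M) ->
  f \in ell2_pred.
Proof.
move=> fM; apply/asboolP; apply: (@le_lt_trans _ _ M%:E); last exact: ltry.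
apply: ge_ereal_sup => _ /= [A [finA _] <-].
rewrite fsbig_finite//= sumEFin lee_fin; apply: fM; exact: fset_uniq.
Qed.

Lemma sqsum_ub (f : T -> R[i]) : f \in ell2_pred ->
  exists M : R, forall s : seq T, uniq s -> \sum_(t <- s) sqmod (f t) <= M.
Proof.
move=> /asboolP fy.
have f0 : (0 <= sqsum f)%E by apply: esum_ge0 => t _; rewrite lee_fin sqmod_ge0.
exists (fine (sqsum f)) => s us.
rewrite -lee_fin fineK ?ge0_fin_numE//.
apply: ereal_sup_ubound; exists [set` s].
  by split=> //; exact: finite_seq.
by rewrite -fsbig_seq// sumEFin.
Qed.

Lemma ell2_submod : submod_closed ell2_pred.
Proof.
split=> [|a f g /sqsum_ub[M fM] /sqsum_ub[N gN]].
  apply: (@sqsum_bounded _ 0) => s _.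
  by rewrite big1// => t _; rewrite /sqmod/= expr0n addr0.
apply: (@sqsum_bounded _ (2 * sqmod a * M + 2 * N)) => s us.
apply: (@le_trans _ _ (\sum_(t <- s)
    (2 * sqmod a * sqmod (f t) + 2 * sqmod (g t)))).
  apply: ler_sum => t _; apply: le_trans (sqmodD _ _) _.
  by rewrite sqmodM mulrA.
by rewrite big_split/= -!mulr_sumr lerD ?ler_wpM2l ?mulr_ge0 ?sqmod_ge0 ?fM ?gN.
Qed.

HB.instance Definition _ :=
  GRing.isSubmodClosed.Build _ _ ell2_pred ell2_submod.

(* The Hilbert space l^2(T), with orthonormal basis indexed by T. *)
Record ell2 := Ell2 { ell2_fun :> T -> R[i] ; _ : ell2_fun \in ell2_pred }.

HB.instance Definition _ := [isSub for ell2_fun].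
HB.instance Definition _ := [Choice of ell2 by <:].
HB.instance Definition _ := [SubChoice_isSubLmodule of ell2 by <:].

Definition l2norm (f : ell2) : R := Num.sqrt (fine (sqsum f)).

Lemma basis_subproof (t : T) :
  (fun u => (u == t)%:R : R[i]) \in ell2_pred.
Proof.
apply: (@sqsum_bounded _ 1) => s us.
rewrite (eq_bigr (fun u => if u == t then 1 else 0 : R)); last first.
  by move=> u _; rewrite /sqmod; case: (u == t); rewrite /= ?expr1n ?expr0n ?addr0.
rewrite -big_mkcond/= -big_filter.
rewrite (eq_bigr (fun=> 1)) // big_const_seq count_predT iter_addr_0.
have := count_uniq_mem t us; rewrite size_filter => ->.
by case: (_ \in _); rewrite ?ler01.
Qed.

Definition basis (t : T) : ell2 := Ell2 (basis_subproof t).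

End EllTwo.

Definition bounded_op (R : realType) (T U : choiceType)
    (A : {linear ell2 R T -> ell2 R U}) : Prop :=
  exists M : R, forall f, l2norm (A f) <= M * l2norm f.

Definition bounded_invertible (R : realType) (T : choiceType)
    (A : {linear ell2 R T -> ell2 R T}) : Prop :=
  bounded_op A /\
  exists B : {linear ell2 R T -> ell2 R T},
    [/\ bounded_op B, cancel A B & cancel B A].

Section Modes.
Variable R : realType.

(* A Fock space; the number state |n> is basis R n. *)
Definition mode := ell2 R nat.

(* The Hilbert tensor product of one mode per k : K, realized as l^2(nat^K):
   the coefficient at n is the amplitude of the product number state
   |n_k> over k : K. *)
Definition modes (K : finType) := ell2 R {ffun K -> nat}.

Lemma ptensor_subproof (K : finType) (v : K -> mode) :
  (fun n : {ffun K -> nat} => \prod_k v k (n k)) \in @ell2_pred R _.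
Proof.
have [M vM] : {M : K -> R & forall k (s : seq nat), uniq s ->
    \sum_(t <- s) sqmod (v k t) <= M k}.
  apply: (@boolp.choice K R (fun k M => forall s : seq nat, uniq s ->
    \sum_(t <- s) sqmod (v k t) <= M)) => k.
  by apply: sqsum_ub; exact: valP.
apply: (@sqsum_bounded _ _ _ (\prod_k M k)) => s us.
have sqmod_prod (n : {ffun K -> nat}) :
    sqmod (\prod_k v k (n k)) = \prod_k sqmod (v k (n k)).
  apply: (big_morph (@sqmod R)); first exact: sqmodM.
  by rewrite /sqmod/= expr1n expr0n addr0.
pose N := (\max_(n <- s) \max_k n k).+1.
have sN n k : n \in s -> (n k < N)%N.
  move=> ns; rewrite ltnS; apply: (@leq_trans (\max_k n k)).
    exact: (leq_bigmax (F := fun k => n k)).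
  by rewrite (big_rem n)//= leq_maxl.
pose trunc (n : {ffun K -> nat}) : {ffun K -> 'I_N} := [ffun k => inord (n k)].
have truncK n : n \in s -> [ffun k => val (trunc n k)] = n.
  by move=> ns; apply/ffunP => k; rewrite !ffunE/= inordK// sN.
pose F (p : {ffun K -> 'I_N}) := \prod_k sqmod (v k (p k)).
have F0 p : 0 <= F p by apply: prodr_ge0 => k _; exact: sqmod_ge0.
have -> : \sum_(n <- s) sqmod (\prod_k v k (n k)) =
          \sum_(p <- map trunc s) F p.
  rewrite big_map !big_seq; apply: eq_bigr => n ns.
  by rewrite sqmod_prod; apply: eq_bigr => k _; rewrite ffunE inordK// sN.
have ut : uniq (map trunc s).
  rewrite map_inj_in_uniq// => n n' ns n's e.
  by rewrite -(truncK n)// -(truncK n')// e.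
rewrite big_uniq//=.
apply: (@le_trans _ _ (\sum_p F p)).
  by rewrite [leRHS](bigID (mem (map trunc s)))/= lerDl sumr_ge0.
rewrite /F -(bigA_distr_bigA (fun k (i : 'I_N) => sqmod (v k i))).
apply: ler_prod => k _; rewrite sumr_ge0/= => [|i _]; last exact: sqmod_ge0.
have := vM k (index_iota 0 N) (iota_uniq _ _).
by rewrite big_mkord.
Qed.

Definition ptensor (K : finType) (v : K -> mode) : modes K :=
  Ell2 (ptensor_subproof v).

(* T is the tensor product of the A k. Such a bounded T exists whenever all the
   A k are bounded, and is unique because product vectors span a dense
   subspace. *)
Definition is_tensor_op (K : finType) (A : K -> {linear mode -> mode})
    (T : {linear modes K -> modes K}) : Prop :=
  bounded_op T /\
  forall v : K -> mode, T (ptensor v) = ptensor (fun k => A k (v k)).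

Definition slocc (K : finType) (psi phi : modes K) : Prop :=
  exists (A : K -> {linear mode -> mode}) (T : {linear modes K -> modes K}),
    [/\ forall k, bounded_invertible (A k), is_tensor_op A T & phi = T psi].

Definition ghz (m r : nat) : modes 'I_m :=
  ((Num.sqrt r%:R)^-1)%:C *:
    \sum_(k < r) ptensor (fun _ : 'I_m => basis R (val k)).

Definition restrict_modes (K : finType) (I : {set K}) (n : {ffun K -> nat}) :
  {ffun {k | k \in I} -> nat} := [ffun k => n (val k)].

(* psi is a sum of s simple tensors a i (x) b i, with a i in the tensor product
   of the modes of I, and b i in that of the modes of J. *)
Definition has_tensor_decomposition (K : finType) (I J : {set K})
    (psi : modes K) (s : nat) : Prop :=
  exists (a : 'I_s -> modes {k | k \in I}) (b : 'I_s -> modes {k | k \in J}),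
    forall n : {ffun K -> nat},
      psi n = \sum_(i < s) a i (restrict_modes I n) * b i (restrict_modes J n).

Definition bipartition (K : finType) (I J : {set K}) : Prop :=
  [/\ I :|: J = [set: K]%SET, I :&: J = finset.set0, I != finset.set0
    & J != finset.set0].

Definition schmidt_rank_is (K : finType) (I J : {set K})
    (psi : modes K) (r : nat) : Prop :=
  has_tensor_decomposition I J psi r /\
  forall s, has_tensor_decomposition I J psi s -> (r <= s)%N.

End Modes.

(* Main.v *)
(* For a bipartition I, J the amplitudes of a vector at the number states equal
   to i on I and to j on J, for i, j < n, form an n x n matrix whose rank is at
   most the Schmidt rank. For GHZ_(r) and n = r it is 1/sqrt r times the
   identity. A vector SLOCC-equivalent to GHZ_(r) is again a sum of r product
   vectors, so its r' x r' matrix has rank at most r < r'; it therefore stays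
   away from 1/sqrt r' times the identity, as matrices close to a nonzero scalar
   matrix are invertible. Conversely, a diagonal operator on a single mode can
   shrink the terms k >= r' of GHZ_(r) and rescale the others. *)
Require Import Defs.
From mathcomp Require Import all_boot all_order all_algebra.
From mathcomp Require Import all_classical all_reals all_analysis.
From mathcomp Require Import finmap lra.
From HB Require Import structures.
Import Order.TTheory GRing.Theory Num.Theory.
Local Open Scope ring_scope.
Local Open Scope complex_scope.
Local Open Scope classical_set_scope.
Set Implicit Arguments.
Unset Strict Implicit.
Unset Printing Implicit Defensive.

(** * Invertibility of matrices close to a scalar matrix *)

(* If u P = 0, summing |c u_j| <= e \sum_i |u_i| over j gives
   c |u|_1 <= n e |u|_1. *)
Lemma near_scalar_mx_row_free (C : numFieldType) n (P : 'M[C]_n) (c e : C) :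
  (forall i j, `|P i j - c *+ (i == j)| <= e) -> e *+ n < c -> row_free P.
Proof.
move=> Pc ec; rewrite -kermx_eq0; apply/negPn/negP => /rowV0Pn[u].
rewrite sub_kermx => /eqP uP /negP; apply; apply/eqP.
(* In dimension 0 no entry forces [e] to be nonnegative, but every row vector is zero. *)
case: n => [|n] in P Pc ec u uP *; first exact: thinmx0.
have e0 : 0 <= e by apply: le_trans (normr_ge0 _) (Pc ord0 ord0).
have c0 : 0 < c by apply: le_lt_trans ec; rewrite mulrn_wge0.
pose S := \sum_j `|u 0 j|.
have cu j : c * `|u 0 j| <= e * S.
  have -> : c * `|u 0 j| = `|\sum_i u 0 i * (P i j - c *+ (i == j))|.
    rewrite (eq_bigr (fun i => u 0 i * P i j - u 0 i * (c *+ (i == j)))); last first.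
      by move=> i _; rewrite mulrBr.
    rewrite big_split/=; have := congr1 (fun M : 'rV_n.+1 => M 0 j) uP.
    rewrite !mxE => ->; rewrite add0r (bigD1 j)//= eqxx big1 ?addr0.
      by rewrite normrN mulr1n normrM (gtr0_norm c0) mulrC.
    by move=> i /negPf->; rewrite mulr0n mulr0 oppr0.
  apply: (le_trans (ler_norm_sum _ _ _)); rewrite /S mulr_sumr.
  by apply: ler_sum => i _; rewrite normrM mulrC ler_wpM2r.
have S0 : 0 <= S by exact: sumr_ge0.
have cS : c * S <= e *+ n.+1 * S.
  rewrite {1}/S mulr_sumr (le_trans (ler_sum _ (fun j _ => cu j)))//.
  by rewrite sumr_const card_ord mulrnAl.
have : S = 0.
  apply/eqP; move: S0; rewrite le0r => /predU1P[->//|S0].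
  by move: cS; rewrite ler_pM2r// lt_geF.
move=> /eqP; rewrite psumr_eq0// => /allP uS.
apply/rowP => j; rewrite mxE; apply/eqP; rewrite -normr_eq0.
exact: (implyP (uS j (mem_index_enum _))).
Qed.

(** * Norm and coordinates in l^2 *)

Section EllTwoTheory.
Variables (R : realType) (T : choiceType).
Implicit Types (f g : ell2 R T) (t : T) (a : R[i]).

Lemma ell2P f g : f =1 g -> f = g.
Proof. by move=> fg; apply/val_inj/funext. Qed.

Lemma ell2_sumE (I : Type) (s : seq I) (P : pred I) (F : I -> ell2 R T) t :
  (\sum_(i <- s | P i) F i) t = \sum_(i <- s | P i) F i t.
Proof. exact: (big_morph (fun f : ell2 R T => f t)). Qed.

Lemma sqsum_ge0 f : (0 <= sqsum f)%E.
Proof. by apply: esum_ge0 => t _; rewrite lee_fin sqmod_ge0. Qed.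

Lemma sqr_l2norm f : l2norm f ^+ 2 = fine (sqsum f).
Proof. by rewrite sqr_sqrtr// fine_ge0// sqsum_ge0. Qed.

(** Together with [l2norm_le], this makes the squared norm the least upper bound of the finite
    partial sums, so that norm estimates reduce to finite sums. *)
Lemma sum_sqmod_le_l2norm f (s : seq T) : uniq s ->
  \sum_(t <- s) sqmod (f t) <= l2norm f ^+ 2.
Proof.
move=> us; rewrite sqr_l2norm -lee_fin fineK.
  apply: ereal_sup_ubound; exists [set` s]; last by rewrite -fsbig_seq// sumEFin.
  by split=> //; exact: finite_seq.
by rewrite ge0_fin_numE ?sqsum_ge0//; apply/asboolP; exact: (valP f).
Qed.

Lemma l2norm_le f (M : R) : 0 <= M ->
  (forall s : seq T, uniq s -> \sum_(t <- s) sqmod (f t) <= M ^+ 2) ->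
  l2norm f <= M.
Proof.
move=> M0 fM; rewrite -(@ler_pXn2r _ 2)// ?nnegrE ?sqrtr_ge0// sqr_l2norm.
rewrite -lee_fin fineK.
  apply: ge_ereal_sup => _ /= [A [finA _] <-].
  by rewrite fsbig_finite//= sumEFin lee_fin; apply: fM; exact: fset_uniq.
by rewrite ge0_fin_numE ?sqsum_ge0//; apply/asboolP; exact: (valP f).
Qed.

Lemma normc_sqmod a : `|a| = (Num.sqrt (sqmod a))%:C.
Proof. by rewrite normc_def. Qed.

Lemma norm_le_l2norm f t : `|f t| <= (l2norm f)%:C.
Proof.
rewrite normc_sqmod lecR -(ger0_norm (sqrtr_ge0 _ : 0 <= l2norm f)) -sqrtr_sqr.
rewrite ler_wsqrtr//; have := @sum_sqmod_le_l2norm f [:: t] isT.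
by rewrite big_seq1.
Qed.

End EllTwoTheory.


(** * Bounded diagonal operators *)

Section DiagonalOperator.
Variables (R : realType) (T : choiceType) (d : T -> R[i]) (M : R).
Hypothesis dM : forall t, sqmod (d t) <= M ^+ 2.

(** The hypothesis bounds the entries by [M ^+ 2] and leaves the sign of [M] open, hence the
    absolute value. *)
Lemma sum_sqmod_diag (f : ell2 R T) (s : seq T) : uniq s ->
  \sum_(t <- s) sqmod (d t * f t) <= (`|M| * l2norm f) ^+ 2.
Proof.
move=> us; rewrite exprMn real_normK ?num_real//.
apply: (@le_trans _ _ (M ^+ 2 * \sum_(t <- s) sqmod (f t))).
  rewrite mulr_sumr; apply: ler_sum => t _.
  by rewrite sqmodM ler_wpM2r ?sqmod_ge0.
by rewrite ler_wpM2l ?sqr_ge0 ?sum_sqmod_le_l2norm.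
Qed.

Lemma diag_op_subproof (f : ell2 R T) :
  (fun t => d t * f t) \in @ell2_pred R T.
Proof. by apply: sqsum_bounded => s us; exact: sum_sqmod_diag. Qed.

Definition diag_op (f : ell2 R T) : ell2 R T := Ell2 (diag_op_subproof f).

Lemma diag_op_is_linear : linear diag_op.
Proof. by move=> a f g; apply: ell2P => t /=; rewrite mulrDr mulrCA. Qed.

HB.instance Definition _ :=
  GRing.isLinear.Build R[i] (ell2 R T) (ell2 R T) *:%R diag_op diag_op_is_linear.

Lemma diag_op_norm f : l2norm (diag_op f) <= `|M| * l2norm f.
Proof.
apply: l2norm_le => [|s us]; first by rewrite mulr_ge0// sqrtr_ge0.
exact: sum_sqmod_diag.
Qed.

Lemma diag_op_bounded : bounded_op diag_op.
Proof. by exists `|M|; exact: diag_op_norm. Qed.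

Lemma diag_op_basis t : diag_op (Defs.basis R t) = d t *: Defs.basis R t.
Proof.
apply: ell2P => u /=; rewrite -[RHS]/(d t * (u == t)%:R).
by case: eqP => [->//|_]; rewrite !mulr0.
Qed.

End DiagonalOperator.

(** The inverse is the diagonal operator with reciprocal entries, bounded thanks to [N]. *)
Lemma diag_op_bounded_invertible (R : realType) (T : choiceType)
    (d : T -> R[i]) (M N : R) (dM : forall t, sqmod (d t) <= M ^+ 2) :
  (forall t, d t != 0) -> (forall t, sqmod (d t)^-1 <= N ^+ 2) ->
  bounded_invertible (diag_op dM).
Proof.
move=> d0 dN; split; first exact: diag_op_bounded.
exists (diag_op dN); split; first exact: diag_op_bounded.
- by move=> f; apply: ell2P => t /=; rewrite mulKf.
- by move=> f; apply: ell2P => t /=; rewrite mulVKf.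
Qed.

(** Scaling is the diagonal operator with constant entry [a]. *)
Lemma l2norm_realZ (R : realType) (T : choiceType) (a : R) (f : ell2 R T) :
  l2norm (a%:C *: f) <= `|a| * l2norm f.
Proof.
have aM (t : T) : sqmod a%:C <= a ^+ 2 by rewrite /sqmod/= expr0n addr0.
have -> : a%:C *: f = diag_op aM f by exact: ell2P.
exact: diag_op_norm.
Qed.

(** * Product vectors, tensor operators and bipartitions *)

Section Modes.
Variables (R : realType) (K : finType).
Implicit Types (v : K -> mode R) (I J : {set K}).

Lemma sqmod_prod (z : K -> R[i]) : sqmod (\prod_k z k) = \prod_k sqmod (z k).
Proof.
apply: (big_morph (@sqmod R)); first exact: sqmodM.
by rewrite /sqmod/= expr1n expr0n addr0.
Qed.

Section DiagonalTensor.
Variables (d : K -> nat -> R[i]) (M : K -> R).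
Hypothesis dM : forall k n, sqmod (d k n) <= M k ^+ 2.

Lemma tensor_diag_subproof (n : {ffun K -> nat}) :
  sqmod (\prod_k d k (n k)) <= (\prod_k M k) ^+ 2.
Proof.
rewrite sqmod_prod -prodrXl; apply: ler_prod => k _.
by rewrite sqmod_ge0 dM.
Qed.

(** Diagonal operators tensor to a diagonal operator: at [n] its entry is the product of the entries
    at the [n k]. *)
Lemma is_tensor_op_diag :
  is_tensor_op (fun k => diag_op (dM k)) (diag_op tensor_diag_subproof).
Proof.
split=> [|v]; first exact: diag_op_bounded.
by apply: ell2P => n /=; rewrite big_split.
Qed.

End DiagonalTensor.

Lemma ptensor_basis (n : {ffun K -> nat}) :
  ptensor (fun k => Defs.basis R (n k)) = Defs.basis R n.
Proof.
apply: ell2P => p /=; have [->|pn] := eqVneq p n.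
  by rewrite big1// => k _; rewrite eqxx.
have [k pnk] : exists k, p k != n k.
  by apply/existsP; rewrite -negb_forall; apply: contra pn => /forallP e;
    apply/eqP/ffunP => k; exact/eqP.
by rewrite (bigD1 k)//= (negPf pnk) mul0r.
Qed.

Lemma ptensor_restrict I J v (n : {ffun K -> nat}) : bipartition I J ->
  ptensor v n = ptensor (fun k => v (val k)) (restrict_modes I n) *
                ptensor (fun k => v (val k)) (restrict_modes J n).
Proof.
move=> [IJT IJ0 _ _] /=.
have JE k : (k \in J) = (k \notin I).
  have /setP/(_ k) := IJT; have /setP/(_ k) := IJ0.
  by rewrite !inE; case: (k \in I); case: (k \in J).
rewrite (bigID (mem I))/= -(eq_bigl _ _ JE).
by congr (_ * _); rewrite big_sub; apply: eq_bigr => k _; rewrite ffunE.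
Qed.

(** Each product vector splits into its factors on [I] and on [J]; the scalar is absorbed into the
    first. *)
Lemma has_tensor_decomposition_sum I J (c : R[i]) s (v : 'I_s -> K -> mode R) :
  bipartition I J ->
  has_tensor_decomposition I J (c *: \sum_(i < s) ptensor (v i)) s.
Proof.
move=> IJ; exists (fun i => c *: ptensor (fun k => v i (val k))),
  (fun i => ptensor (fun k => v i (val k))) => n.
rewrite -[LHS]/(c * (\sum_i ptensor (v i)) n) ell2_sumE mulr_sumr.
apply: eq_bigr => i _; rewrite (ptensor_restrict _ _ IJ) mulrA.
by congr (_ * _).
Qed.

Definition two_level I (i j : nat) : {ffun K -> nat} :=
  [ffun k => if k \in I then i else j].

Lemma restrict_two_level I J i j : bipartition I J ->
  (restrict_modes I (two_level I i j) = [ffun=> i]) *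
  (restrict_modes J (two_level I i j) = [ffun=> j]).
Proof.
move=> [_ IJ0 _ _]; split; apply/ffunP => -[k kI]; rewrite !ffunE /=.
  by rewrite kI.
by have /setP/(_ k) := IJ0; rewrite !inE kI andbT => ->.
Qed.

(** A decomposition into [s] simple tensors factors the matrix through dimension [s]. *)
Lemma rank_two_level_le I J (psi : modes R K) s n : bipartition I J ->
  has_tensor_decomposition I J psi s ->
  (\rank (\matrix_(i < n, j < n) psi (two_level I i j)) <= s)%N.
Proof.
move=> IJ [a [b psiE]].
have -> : \matrix_(i < n, j < n) psi (two_level I i j) =
    (\matrix_(i < n, k < s) a k [ffun=> val i]) *m
    (\matrix_(k < s, j < n) b k [ffun=> val j]).
  apply/matrixP => i j; rewrite !mxE psiE; apply: eq_bigr => k _.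
  by rewrite !mxE !(restrict_two_level i j IJ).
by rewrite (leq_trans (mxrankM_maxl _ _))// rank_leq_col.
Qed.

End Modes.

(** * GHZ states: Schmidt rank and approximation *)

Section GHZ.
Variables (R : realType) (m : nat).

Local Notation amp r := ((Num.sqrt r%:R)^-1 : R).

Lemma ghz_amp_gt0 r : (0 < r)%N -> 0 < amp r.
Proof. by move=> r0; rewrite invr_gt0 sqrtr_gt0 ltr0n. Qed.

Lemma ghzE r : ghz R m r =
  (amp r)%:C *: \sum_(k < r) Defs.basis R [ffun=> val k].
Proof.
congr (_ *: _); apply: eq_bigr => k _; rewrite -ptensor_basis.
by apply: ell2P => n /=; apply: eq_bigr => i _; rewrite ffunE.
Qed.

Lemma ghz_two_level r (I J : {set 'I_m}) (i j : 'I_r) : bipartition I J ->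
  ghz R m r (two_level I i j) = (amp r)%:C *+ (i == j).
Proof.
move=> [_ IJ0 /set0Pn[p pI] /set0Pn[q qJ]].
have qI : q \notin I.
  by have /setP/(_ q) := IJ0; rewrite !inE qJ andbT => ->.
rewrite ghzE -[LHS]/((amp r)%:C * (\sum_(k < r) Defs.basis R _) _) ell2_sumE /=.
(* As both blocks are nonempty, comparing at [p] gives [i = k] and comparing at [q] gives
   [j = k]. *)
have E (k : 'I_r) : (two_level I i j == [ffun=> val k]) = (k == i) && (i == j).
  apply/eqP/andP => [/ffunP e|[/eqP-> /eqP<-]]; last first.
    by apply/ffunP => x; rewrite !ffunE if_same.
  have := e p; have := e q; rewrite !ffunE pI (negPf qI) => jk ik.
  by split; apply/eqP/val_inj => //=; rewrite jk.
under eq_bigr do rewrite E.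
rewrite (bigD1 i)//= eqxx big1 => [|k /negPf->//].
by rewrite addr0 mulr_natr.
Qed.

Lemma ghz_two_level_mx r (I J : {set 'I_m}) : bipartition I J ->
  \matrix_(i < r, j < r) ghz R m r (two_level I i j) = ((amp r)%:C)%:M.
Proof. by move=> IJ; apply/matrixP => i j; rewrite !mxE (ghz_two_level _ _ IJ). Qed.

Lemma schmidt_rank_ghz r (I J : {set 'I_m}) : (0 < r)%N -> bipartition I J ->
  schmidt_rank_is I J (ghz R m r) r.
Proof.
move=> r0 IJ; split=> [|s /(rank_two_level_le r IJ)].
  exact: has_tensor_decomposition_sum.
rewrite (ghz_two_level_mx _ IJ) -scalemx1 mxrank_scale_nz ?mxrank1//.
by rewrite gt_eqF// ltcR ghz_amp_gt0.
Qed.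

(** By linearity [T] acts term by term, and it sends each product vector to a product vector. *)
Lemma slocc_tensor_decomposition r (phi : modes R 'I_m) (I J : {set 'I_m}) :
  bipartition I J -> slocc (ghz R m r) phi -> has_tensor_decomposition I J phi r.
Proof.
move=> IJ [A [T [_ [_ TA] ->]]]; rewrite /ghz linearZ linear_sum/=.
under eq_bigr do rewrite TA.
exact: has_tensor_decomposition_sum.
Qed.

(** The radius is the threshold of [near_scalar_mx_row_free] for size [r'] and scalar [amp r']. Any
    bipartition would do; the proof splits off the first mode. *)
Lemma slocc_ghz_far r r' (phi : modes R 'I_m) : (1 < m)%N -> (r < r')%N ->
  slocc (ghz R m r) phi -> amp r' / r'%:R <= l2norm (phi - ghz R m r').
Proof.
move=> m1 rr' sphi; rewrite leNgt; apply/negP => lt_e.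
have m0 : (0 < m)%N by exact: ltnW.
pose p : 'I_m := Ordinal m0; pose q : 'I_m := Ordinal m1.
have IJ : bipartition [set p]%SET (~: [set p])%SET.
  split; [exact: finset.setUCr | exact: finset.setICr | |].
    by apply/set0Pn; exists p; rewrite !inE.
  by apply/set0Pn; exists q; rewrite !inE.
have := rank_two_level_le r' IJ (slocc_tensor_decomposition IJ sphi).
suff /eqP -> : row_free (\matrix_(i < r', j < r') phi (two_level [set p]%SET i j)).
  by rewrite leqNgt rr'.
apply: (@near_scalar_mx_row_free _ _ _ (amp r')%:C
    (l2norm (phi - ghz R m r'))%:C) => [i j|].
  rewrite mxE -(ghz_two_level _ _ IJ).
  exact: (norm_le_l2norm (phi - ghz R m r')).
rewrite -rmorphMn ltcR -mulr_natr -ltr_pdivlMr// ltr0n.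
exact: leq_ltn_trans rr'.
Qed.

(* Rescale the basis of a single mode: on |k> with k < r' by the ratio of the
   amplitudes, on the other |k> by a small nonzero x. *)
Lemma slocc_ghz_near r r' (eps : R) : (0 < m)%N -> (0 < r')%N -> (r' < r)%N ->
  0 < eps -> exists phi : modes R 'I_m,
    slocc (ghz R m r) phi /\ l2norm (phi - ghz R m r') < eps.
Proof.
move=> m0 r'0 r'r eps0; pose p : 'I_m := Ordinal m0.
have r0 : (0 < r)%N by exact: ltn_trans r'r.
(* The tail of [ghz R m r]; the final error is [x] times [w]. *)
pose w : modes R 'I_m :=
  (amp r)%:C *: \sum_(k < r | ~~ (k < r')%N) Defs.basis R [ffun=> val k].
(* Adding 1 keeps the denominator positive and makes the final bound strict. *)
pose x := eps / (l2norm w + 1).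
have w1 : 0 < l2norm w + 1 by rewrite ltr_wpDl ?sqrtr_ge0.
have x0 : 0 < x by rewrite divr_gt0.
pose y := amp r' / amp r.
have y0 : 0 < y by rewrite divr_gt0 ?ghz_amp_gt0.
pose e (k : nat) := if (k < r')%N then y else x.
(* Only mode [p] is rescaled, so the product of the entries at a constant state [k] is [e k]. *)
pose d (i : 'I_m) (k : nat) : R[i] := if i == p then (e k)%:C else 1.
have sqC (a : R) : sqmod a%:C = a ^+ 2 by rewrite /sqmod/= expr0n addr0.
(* The bound [a + b + 1] dominates both values of [e] as well as the entry 1 on the other modes; it
   serves again for the reciprocals. *)
have bound (a b : R) : 0 < a -> 0 < b -> forall k : nat,
    (if (k < r')%N then a else b) ^+ 2 <= (a + b + 1) ^+ 2.
  by move=> a0 b0 k; case: ifP => _; rewrite ler_pXn2r ?nnegrE//; lra.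
have dM i k : sqmod (d i k) <= (y + x + 1) ^+ 2.
  rewrite /d; case: eqP => _; first by rewrite sqC bound.
  by rewrite sqC ler_pXn2r ?nnegrE//; lra.
have dN i k : sqmod (d i k)^-1 <= (y^-1 + x^-1 + 1) ^+ 2.
  rewrite /d; case: eqP => _.
    rewrite -(fmorphV (real_complex R)) sqC /e.
    by rewrite (fun_if (@GRing.inv R)) bound ?invr_gt0.
  have yV0 : 0 < y^-1 by rewrite invr_gt0.
  have xV0 : 0 < x^-1 by rewrite invr_gt0.
  by rewrite invr1 sqC ler_pXn2r ?nnegrE//; lra.
have d0 i k : d i k != 0.
  rewrite /d; case: (i == p); last exact: oner_neq0.
  by rewrite fmorph_eq0 /e; case: ifP => _; rewrite gt_eqF.
have [T_bounded T_prod] := is_tensor_op_diag dM.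
set T := diag_op _ in T_bounded T_prod.
exists (T (ghz R m r)); split.
  exists (fun i => diag_op (dM i)), T; split=> // i.
  exact: (diag_op_bounded_invertible (dM i) (d0 i) (dN i)).
have TE (k : nat) : T (Defs.basis R [ffun=> k]) = (e k)%:C *: Defs.basis R [ffun=> k].
  rewrite /T diag_op_basis; congr (_ *: _).
  rewrite (bigD1 p)//= big1 => [|i /negPf ip]; last by rewrite /d ip.
  by rewrite /d eqxx ffunE mulr1.
have Tghz : T (ghz R m r) =
    (amp r)%:C *: \sum_(k < r) (e k)%:C *: Defs.basis R [ffun=> val k].
  rewrite ghzE /T linearZ linear_sum/=; congr (_ *: _).
  by apply: eq_bigr => k _; exact: TE.
(* By the choice of [y], the terms [k < r'] cancel exactly. *)
have -> : T (ghz R m r) - ghz R m r' = x%:C *: w.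
  rewrite Tghz ghzE.
  rewrite (bigID (fun k : 'I_r => (k < r')%N))/= scalerDr.
  rewrite (big_ord_narrow (ltnW r'r)) /=.
  rewrite (eq_bigr (fun k : 'I_r' => y%:C *: Defs.basis R [ffun=> val k])); last first.
    by move=> k _; rewrite /e ltn_ord.
  rewrite -scaler_sumr scalerA -rmorphM /y mulrC divfK ?gt_eqF ?ghz_amp_gt0//.
  rewrite addrAC subrr add0r /w scalerA mulrC -scalerA; congr (_ *: _).
  by rewrite scaler_sumr; apply: eq_bigr => k /negPf kr'; rewrite /e kr'.
apply: le_lt_trans (l2norm_realZ _ _) _; rewrite gtr0_norm// /x mulrAC.
by rewrite ltr_pdivrMr// ltr_pM2l// ltrDl.
Qed.

End GHZ.

Theorem mainTheorem6 (R : realType) (m : nat) (hm : (2 <= m)%N) :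
  (forall r : nat, (1 <= r)%N ->
     forall I J : {set 'I_m}, bipartition I J ->
       schmidt_rank_is I J (ghz R m r) r) /\
  (forall r r' : nat, (1 <= r)%N -> (1 <= r')%N -> (r' < r)%N ->
     forall eps : R, 0 < eps ->
       exists phi : modes R 'I_m,
         slocc (ghz R m r) phi /\ l2norm (phi - ghz R m r') < eps) /\
  (forall r r' : nat, (1 <= r)%N -> (1 <= r')%N -> (r < r')%N ->
     ~ (forall eps : R, 0 < eps ->
          exists phi : modes R 'I_m,
            slocc (ghz R m r) phi /\ l2norm (phi - ghz R m r') < eps)).
Proof.
split; [|split].
- by move=> r r0 I J; exact: schmidt_rank_ghz.
- by move=> r r' _ r'0 r'r eps; exact: slocc_ghz_near (ltnW hm) r'0 r'r.
move=> r r' _ r'0 rr' near_ghz.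
(* The radius excluded by [slocc_ghz_far] is itself a positive tolerance. *)
have eps0 : 0 < (Num.sqrt r'%:R)^-1 / r'%:R :> R.
  by rewrite divr_gt0 ?ghz_amp_gt0 ?ltr0n.
have [phi [sphi]] := near_ghz _ eps0.
by rewrite ltNge (slocc_ghz_far hm rr' sphi).
Qed.
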